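(* Let $q$ be a prime power, let $\gamma$ be a primitive element of $\mathbb{F}_{q^2}$, and for any integer $a$ let $h_a(x)\in\mathbb{F}_q[x]$ denote the minimal polynomial of $\gamma^{-a}$ over $\mathbb{F}_q$. For integers $e_1,e_2$, let $\mathcal{C}_{((q+1)e_1,e_2)}$ be the cyclic code of length $q^2-1$ over $\mathbb{F}_q$ whose parity-check polynomial is $h_{(q+1)e_1}(x)h_{e_2}(x)$. Suppose $\gcd(q-1,2e_1-e_2)=1$ and $\gcd(q+1,e_2)=1$. Then: (A) $\deg(h_{(q+1)e_1}(x))=1$ and $\deg(h_{e_2}(x))=2$. Moreover, $h_{(q+1)e_1}(x)$ and $h_{e_2}(x)$ are the parity-check polynomials of two different one-weight cyclic codes of length $q^2-1$ over $\mathbb{F}_q$, whose (unique) nonzero weights are $q^2-1$ and $q(q-1)$, respectively. (B) $\mathcal{C}_{((q+1)e_1,e_2)}$ is an optimal three-weight $[q^2-1,3,q(q-1)-1]$ cyclic code over $\mathbb{F}_q$ whose weight distribution is: weight $0$ with frequency $1$; weight $q(q-1)-1$ with frequency $(q-1)(q^2-1)$; weight $q(q-1)$ with frequency $q^2-1$; weight $q^2-1$ with frequency $q-1$ (and no other weights occur). Moreover, if $B_j$ ($0<j\le q^2-1$) denotes the number of codewords of weight $j$ in the dual code of $\mathcal{C}_{((q+1)e_1,e_2)}$, then $B_1=B_2=0$ and $$B_3=\frac{(q^2-3)(q^2-1)(q-2)(q-1)}{6}.$$ Consequently, if $q>2$, the dual code of $\mathcal{C}_{((q+1)e_1,e_2)}$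 is a single-error-correcting cyclic code with parameters $[q^2-1,q^2-4,3]$.
   Context: A linear $[n,k,d]$ code over $\mathbb{F}_q$ is called optimal here if its length attains the Griesmer lower bound, i.e. $n=\sum_{i=0}^{k-1}\lceil d/q^i\rceil$. A one-weight (resp. three-weight) code is one having exactly one (resp. three) distinct nonzero Hamming weights. *)

(* Defs.v *)
From HB Require Import structures.
From mathcomp Require Import all_boot all_order all_algebra all_field.
Set Implicit Arguments. Unset Strict Implicit. Unset Printing Implicit Defensive.
Import Order.TTheory GRing.Theory Num.Theory.
Local Open Scope ring_scope.

Section Codes.
Variables (F : finFieldType) (n : nat).

Definition hdist (x y : 'rV[F]_n) : nat := #|[set i | x 0 i != y 0 i]|.
Definition wt (x : 'rV[F]_n) : nat := hdist x 0.

Definition wpoly (c : 'rV[F]_n) : {poly F} := \sum_(i < n) c 0 i *: 'X^i.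

(* The cyclic code of length n over F with parity-check polynomial h:
   the ideal of F[x]/(x^n - 1) generated by g = (x^n - 1)/h. *)
Definition cyclic_code (h : {poly F}) : {set 'rV[F]_n} :=
  [set c | (('X^n - 1) %/ h) %| wpoly c].

Definition dual_code (C : {set 'rV[F]_n}) : {set 'rV[F]_n} :=
  [set x | [forall c in C, (c *m x^T) 0 0 == 0]].

Definition code_dim (C : {set 'rV[F]_n}) : nat := \dim <<enum C>>%VS.

Definition min_dist (C : {set 'rV[F]_n}) (d : nat) : Prop :=
  (exists x y, [/\ x \in C, y \in C, x != y & hdist x y = d]) /\
  (forall x y, x \in C -> y \in C -> x != y -> (d <= hdist x y)%N).

Definition has_params (C : {set 'rV[F]_n}) (k d : nat) : Prop :=
  code_dim C = k /\ min_dist C d.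

Definition wfreq (C : {set 'rV[F]_n}) (j : nat) : nat :=
  #|[set c in C | wt c == j]|.

Definition nz_weights (C : {set 'rV[F]_n}) : seq nat :=
  undup [seq wt c | c <- enum C & c != 0].

Definition one_weight (C : {set 'rV[F]_n}) (w : nat) : Prop :=
  nz_weights C = [:: w].

Definition three_weight (C : {set 'rV[F]_n}) : Prop :=
  size (nz_weights C) = 3%N.

End Codes.

Definition ceil_div (a b : nat) : nat := ((a + b - 1) %/ b)%N.

Definition griesmer_optimal (q n k d : nat) : Prop :=
  n = (\sum_(i < k) ceil_div d (q ^ i))%N.

(* Main.v *)
Require Import Defs.
From HB Require Import structures.
From mathcomp Require Import all_boot all_order all_algebra all_field.
From mathcomp Require Import zify ring.
Import Order.TTheory GRing.Theory Num.Theory.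
Local Open Scope ring_scope.
Set Implicit Arguments. Unset Strict Implicit. Unset Printing Implicit Defensive.

(* Put n = q^2 - 1, delta = gamma^((q+1) e1) and w = gamma^(e2 - (q+1) e1).
   Then delta lies in F_q, gamma^e2 = delta w, and the two gcd conditions say
   exactly that w is again primitive.  Fix a nonzero linear form phi on F_{q^2}.
   The words of the code are the (delta^i (b + phi (a w^i)))_i with b in F_q and
   a in F_{q^2}: such words lie in the code, and there are q^3 of them.  Up to
   rescaling coordinates they are the affine functions on the punctured plane
   F_{q^2} \ {0}, and the weights follow by counting zeros.
   After the same rescaling, a word y lies in the dual iff sum y_i = 0 and
   sum y_i w^i = 0.  Hence B_1 = B_2 = 0, and a dual word of weight 3 with
   ordered support (i, j, k) is determined by u = y_i, v = y_j, X = w^i, Y = w^j,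
   subject to u, v, u + v, X, Y, u X + v Y nonzero and X <> Y; counting these
   configurations gives 6 B_3. *)

(** * Linear and cyclic codes *)

Lemma card_dep_pair (T U : finType) (A : {set T}) (B : T -> {set U}) m :
    {in A, forall x, #|B x| = m} ->
  #|[set p : T * U | (p.1 \in A) && (p.2 \in B p.1)]| = (#|A| * m)%N.
Proof.
move=> Bm; rewrite -sum1dep_card.
rewrite -(pair_big_dep (mem A) (fun x y => y \in B x) (fun _ _ => 1%N)) /=.
by rewrite -sum_nat_const; apply: eq_bigr => x Ax; rewrite sum1_card Bm.
Qed.

Lemma card_notin (T : finType) (s : seq T) :
  uniq s -> #|[set x | x \notin s]| = (#|T| - size s)%N.
Proof.
move=> /card_uniqP <-; rewrite -(cardC (mem s)) addKn.
by apply: eq_card => x; rewrite !inE.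
Qed.

Section CodeFacts.
Variables (F : finFieldType) (n : nat).
Implicit Types (C : {set 'rV[F]_n}) (c x y : 'rV[F]_n).

Lemma wtE x : wt x = #|[set i | x 0 i != 0]|.
Proof. by apply: eq_card => i; rewrite !inE mxE. Qed.

Lemma wt0 : wt (0 : 'rV[F]_n) = 0%N.
Proof. by rewrite wtE; apply: eq_card0 => i; rewrite !inE mxE eqxx. Qed.

Lemma hdist_wt x y : hdist x y = wt (x - y).
Proof. by rewrite wtE; apply: eq_card => i; rewrite !inE !mxE subr_eq0. Qed.

Lemma wt_zeros x : (wt x + #|[set i | x 0%R i == 0%R]| = n)%N.
Proof.
rewrite wtE -[RHS]card_ord -(cardsC [set i | x 0 i != 0]); congr (_ + _)%N.
by apply: eq_card => i; rewrite !inE negbK.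
Qed.

Lemma code_dim_vspace C (U : {vspace 'rV[F]_n}) :
  (forall c, (c \in C) = (c \in U)) -> code_dim C = \dim U.
Proof.
move=> CU; congr (\dim _); apply/eqP; rewrite eqEsubv; apply/andP; split.
  by apply/span_subvP => c; rewrite mem_enum CU.
by apply/subvP => c Uc; apply: memv_span; rewrite mem_enum CU.
Qed.

(** Closure under subtraction turns distances into weights of codewords. Positivity of [d] makes the
    codeword of weight [d] differ from 0. *)
Lemma min_dist_linear C d :
    0 \in C -> {in C &, forall x y, x - y \in C} ->
    (0 < d)%N -> (exists2 c, c \in C & wt c = d) ->
    {in C, forall c, c != 0 -> (d <= wt c)%N} ->
  min_dist C d.
Proof.
move=> C0 CB d_gt0 [c Cc wtc] Cd; split=> [|x y Cx Cy neq_xy].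
  exists c, 0; split; rewrite ?hdist_wt ?subr0 //.
  by apply: contraTneq d_gt0 => c0; rewrite -wtc c0 wt0.
by rewrite hdist_wt Cd ?CB ?subr_eq0.
Qed.

Lemma wt_eq0 x : (wt x == 0%N) = (x == 0).
Proof.
apply/eqP/eqP => [|->]; last exact: wt0.
rewrite wtE => /cards0_eq x0; apply/rowP => i; apply/eqP; rewrite mxE.
by have := in_set0 i; rewrite -x0 inE => /negbFE.
Qed.

Lemma mem_nz_weights C j :
  (j \in nz_weights C) = [exists c in C, (c != 0) && (wt c == j)].
Proof.
rewrite mem_undup; apply/mapP/exists_inP => [[c]|[c Cc /andP[c0 /eqP wtc]]].
  by rewrite mem_filter mem_enum => /andP[c0 Cc] ->; exists c; rewrite ?c0 /=.
by exists c; rewrite // mem_filter c0 mem_enum.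
Qed.

(** Lets the set of nonzero weights be read off the weight distribution. *)
Lemma mem_nz_weights_wfreq C j :
  (j \in nz_weights C) = (j != 0%N) && (wfreq C j != 0%N).
Proof.
rewrite mem_nz_weights -[wfreq C j != _]lt0n; apply/exists_inP/andP.
  case=> c Cc /andP[c0 wtc]; rewrite -(eqP wtc) wt_eq0 c0; split=> //.
  by apply/card_gt0P; exists c; rewrite inE Cc eqxx.
case=> j0 /card_gt0P[c]; rewrite inE => /andP[Cc wtc]; exists c => //.
by rewrite wtc -wt_eq0 (eqP wtc) j0.
Qed.

Lemma one_weight_linear C w :
    (exists2 c, c \in C & c != 0) -> {in C, forall c, c != 0 -> wt c = w} ->
  one_weight C w.
Proof.
(* A permutation of a one-element list is equal to it, so comparing members suffices. *)
move=> [c Cc c0] Cw; apply: perm_small_eq => //.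
apply: uniq_perm; rewrite ?undup_uniq // => j; rewrite inE mem_nz_weights.
apply/exists_inP/eqP => [[c' Cc' /andP[c'0 /eqP<-]] | ->]; first exact: Cw.
by exists c; rewrite // c0 Cw /=.
Qed.

End CodeFacts.

(** * Cyclic codes given by a parity-check polynomial *)

Section CyclicCode.
Variables (F : finFieldType) (n : nat).
Hypothesis n_gt0 : (0 < n)%N.
Implicit Types (h : {poly F}) (c : 'rV[F]_n).

Lemma wpolyE c : wpoly c = rVpoly c.
Proof.
apply/polyP => k; rewrite coef_rVpoly coef_sum.
under eq_bigr do rewrite coefZ coefXn.
case: insubP => [j _ <-|]; last first.
  move=> k_ge; rewrite big1 // => i _; case: eqP => [ki|]; rewrite ?mulr0 //.
  by rewrite ki ltn_ord in k_ge.
rewrite (bigD1 j) //= eqxx mulr1 big1 ?addr0 // => i neq_ij.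
by rewrite eq_sym val_eqE (negPf neq_ij) mulr0.
Qed.

Lemma wpolyD : {morph @wpoly F n : x y / x + y}.
Proof. by move=> x y; rewrite !wpolyE linearD. Qed.

Lemma cyclic_codeD h : {in cyclic_code n h &, forall x y, x + y \in cyclic_code n h}.
Proof. by move=> x y; rewrite !inE wpolyD; apply: dvdp_add. Qed.

(** If h2 = k h1, then (X^n - 1)/h1 = k (X^n - 1)/h2, so the generator for [h2] divides the one for
    [h1]. *)
Lemma cyclic_codeS h1 h2 :
  h1 %| h2 -> h2 %| 'X^n - 1 -> cyclic_code n h1 \subset cyclic_code n h2.
Proof.
move=> h12 h2n; apply/subsetP => c; rewrite !inE; apply: dvdp_trans.
case/dvdpP: h12 => k h2E.
have Xn0 : ('X^n - 1 : {poly F}) != 0 by rewrite -size_poly_gt0 size_XnsubC.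
have h2_0 : h2 != 0 by apply: contraNneq Xn0 => h20; rewrite h20 dvd0p in h2n.
have h1_0 : h1 != 0 by apply: contraNneq h2_0 => h10; rewrite h2E h10 mulr0.
rewrite -{2}(divpK h2n) {3}h2E mulrA mulpK //.
exact: dvdp_mulr.
Qed.

(** A codeword is determined by its quotient by the generator [g], a polynomial of degree below deg
    h. *)
Lemma card_cyclic_code_le h :
  h %| 'X^n - 1 -> (#|cyclic_code n h| <= #|F| ^ (size h).-1)%N.
Proof.
move=> hn; set g := ('X^n - 1) %/ h.
have Xn0 : ('X^n - 1 : {poly F}) != 0 by rewrite -size_poly_gt0 size_XnsubC.
have gh : g * h = 'X^n - 1 by rewrite divpK.
have [g0 h0] : g != 0 /\ h != 0.
  by apply/andP; rewrite -negb_or -mulf_eq0 gh.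
have szgh : ((size g).-1 + (size h).-1 = n)%N.
  have := congr1 (fun p : {poly F} => size p) gh; rewrite size_mul // size_XnsubC //.
  by rewrite (polySpred g0) (polySpred h0) !addnS => -[].
pose f (c : 'rV[F]_n) : 'rV[F]_(size h).-1 := poly_rV (wpoly c %/ g).
have <- : #|{: 'rV[F]_(size h).-1}| = (#|F| ^ (size h).-1)%N by rewrite card_mx mul1n.
apply: (@leq_card_in _ _ f) => x y; rewrite !inE => gx gy.
move=> /(congr1 rVpoly); rewrite !poly_rV_K ?leq_divLR //; last 2 first.
- by rewrite wpolyE size_divp // leq_subLR szgh size_poly.
- by rewrite wpolyE size_divp // leq_subLR szgh size_poly.
move=> /(congr1 (fun p => p * g)); rewrite !divpK // !wpolyE.
exact: (can_inj rVpolyK).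
Qed.

(** By the cardinality bound, an injective family of |F|^(deg h) codewords exhausts the code. *)
Lemma cyclic_codeE (T : finType) (f : T -> 'rV[F]_n) h :
    h %| 'X^n - 1 -> injective f -> (forall t, f t \in cyclic_code n h) ->
    #|T| = (#|F| ^ (size h).-1)%N ->
  cyclic_code n h = [set f t | t : T].
Proof.
move=> hn f_inj fh cT; apply/esym/eqP; rewrite eqEcard.
rewrite card_imset // cT card_cyclic_code_le // andbT.
by apply/subsetP => _ /imsetP[t _ ->].
Qed.

(* Over L the word (theta^i) has polynomial (X^n - 1) / (theta X - 1), a multiple
   of (X^n - 1) / h; a coefficientwise F-linear map preserves such multiples. *)
Lemma linear_orbit_cyclic_code (L : fieldExtType F) (phi : {linear L -> F^o})
    (a theta : L) h :
    theta ^+ n = 1 -> h %| 'X^n - 1 -> root (map_poly (in_alg L) h) theta^-1 ->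
  \row_(i < n) (phi (a * theta ^+ i) : F) \in cyclic_code n h.
Proof.
move=> thn hn /factor_theorem[k hE]; rewrite inE; set g := _ %/ h.
have th0 : theta != 0 by rewrite -unitfE -(unitrX_pos _ n_gt0) thn unitr1.
pose P : {poly L} := \poly_(i < n) theta ^+ i.
pose gL := map_poly (in_alg L) g.
have thXE : theta *: 'X - 1 = theta *: ('X - theta^-1%:P) :> {poly L}.
  by rewrite scalerBr -[(theta^-1)%:P]mulr1 mul_polyC scalerA divff // scale1r.
have PE : P = gL * (theta^-1 *: k).
  have nz : (theta *: 'X - 1 : {poly L}) != 0.
    by rewrite thXE scaler_eq0 (negPf th0) polyXsubC_eq0.
  (* After multiplication by theta X - 1, the left side telescopes to (theta X)^n - 1 and the right
     side becomes the image of g h. *)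
  apply: (mulfI nz); transitivity ('X^n - 1 : {poly L}).
    transitivity ((theta *: 'X) ^+ n - 1 : {poly L}); last first.
      by rewrite exprZn thn scale1r.
    rewrite subrX1; congr (_ * _); rewrite /P poly_def.
    by apply: eq_bigr => i _; rewrite exprZn.
  have := congr1 (map_poly (in_alg L)) (divpK hn); rewrite rmorphM /= hE -/g -/gL.
  rewrite rmorphB /= map_polyXn rmorph1 => <-.
  rewrite thXE -scalerAl -!scalerAr scalerA divff // scale1r.
  by rewrite mulrA mulrC.
have -> : wpoly (\row_(i < n) (phi (a * theta ^+ i) : F)) = map_poly phi (a *: P) :> {poly F}.
  rewrite wpolyE; apply/polyP => i; rewrite coef_rVpoly coef_map /= coefZ coef_poly.
  by case: insubP => [j -> <-|/negPf->]; rewrite ?mxE ?mulr0 ?raddf0.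
apply/dvdpP; exists (map_poly phi (a *: (theta^-1 *: k))).
rewrite mulrC PE scalerAr; apply/polyP => i; rewrite coef_map /= !coefM raddf_sum.
apply: eq_bigr => j _; rewrite !coef_map /=.
by rewrite -scalerAl mul1r linearZ.
Qed.

End CyclicCode.

(** * Affine functions on the punctured plane *)

Section AffineCode.
Variables (F : finFieldType) (L0 : fieldExtType F) (q n : nat).
(** [finvect_type] supplies the finite-type structure needed to count elements of the extension. *)
Local Notation L := (finvect_type L0).
Variables (phi : {linear L -> F^o}) (w : L) (D : F).
Hypotheses (qE : #|F| = q) (dimL : \dim {: L} = 2%N) (nE : n = (q ^ 2 - 1)%N).
Hypotheses (w_prim : n.-primitive_root w) (D_neq0 : D != 0) (phi1 : phi 1 = 1).

Lemma q_gt1 : (1 < q)%N.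
Proof. by rewrite -qE; apply: finNzRing_gt1. Qed.

Lemma cardL : #|{: L}| = (q ^ 2)%N.
Proof.
by rewrite -qE -dimL -card_vspace; apply: eq_card => x; rewrite !inE memvf.
Qed.

Lemma w_neq0 : w != 0.
Proof.
by rewrite -unitfE -(unitrX_pos _ (prim_order_gt0 w_prim)) prim_expr_order ?unitr1.
Qed.

Lemma pow_neq0 i : w ^+ i != 0.
Proof. by rewrite expf_neq0 ?w_neq0. Qed.

Lemma pow_inj : injective (fun i : 'I_n => w ^+ i).
Proof.
move=> i j /eqP; rewrite (eq_prim_root_expr w_prim) !modn_small // => /eqP.
exact: val_inj.
Qed.

(** Since |L| = q^2, every nonzero [x] is an n-th root of unity, hence a power of the primitive root
    [w]. *)
Lemma powP (x : L) : x != 0 -> exists i : 'I_n, w ^+ i = x.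
Proof.
move=> x0; have [|i ->] := prim_rootP w_prim (x := x); last by exists i.
apply: (mulfI x0); rewrite mulr1 -exprS nE subn1 prednK; last first.
  by rewrite expn_gt0 ltnW // q_gt1.
by rewrite -cardL expf_card.
Qed.

Lemma card_pow (P : pred L) :
  #|[set i : 'I_n | P (w ^+ i)]| = #|[set x : L | (x != 0) && P x]|.
Proof.
rewrite -(card_imset _ pow_inj); apply: eq_card => x; rewrite inE.
apply/imsetP/andP => [[i + ->]|[/powP[i <-] Pi]].
  by rewrite inE pow_neq0.
by exists i; rewrite ?inE.
Qed.

(** As phi 1 = 1, the fibre over [s] is the kernel translated by s 1. The q fibres thus have equal
    size, and they partition q^2 elements. *)
Lemma card_fiber t : #|[set x : L | phi x == t]| = q.
Proof.
have fib s : #|[set x : L | phi x == s]| = #|[set x : L | phi x == 0]|.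
  rewrite -[RHS](card_imset _ (addIr (s *: 1))); apply: eq_card => x; rewrite inE.
  apply/eqP/imsetP => [phix|[y + ->]].
    exists (x - s *: 1); last by rewrite subrK.
    by rewrite inE linearB linearZ /= phi1 phix /GRing.scale /= mulr1 subrr.
  by rewrite inE => /eqP y0; rewrite linearD linearZ /= phi1 y0 add0r /GRing.scale /= mulr1.
rewrite fib; apply/eqP; rewrite -(eqn_pmul2l (ltnW q_gt1)) mulnn -cardL -[in X in (X * _)%N]qE.
rewrite -sum_nat_const -[X in _ == X]sum1_card (partition_big phi xpredT) //=.
by apply/eqP/eq_bigr => s _; rewrite sum1dep_card fib.
Qed.

(* Since phi is F-linear, D ^+ i * phi (a * w ^+ i) = phi (a * (D *: w) ^+ i),
   where D *: w = gamma ^ e2. *)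
Definition affine_word (p : F^o * L) : 'rV[F]_n :=
  \row_(i < n) (D ^+ i * (p.1 + phi (p.2 * w ^+ i))).

Lemma affine_word_is_linear : linear affine_word.
Proof.
move=> k [b a] [b' a']; apply/rowP => i; rewrite !mxE /=.
rewrite mulrDl -scalerAl linearD linearZ /= /GRing.scale /=.
ring.
Qed.
HB.instance Definition _ := GRing.isLinear.Build F (F^o * L)%type 'rV[F]_n _ affine_word affine_word_is_linear.

(** Multiplication by [a] permutes the nonzero elements, so the count is that of a fibre of [phi]
    without the origin, which lies in the fibre over 0 only. *)
Lemma card_phi_pow (a : L) (t : F) : a != 0 ->
  #|[set i : 'I_n | phi (a * w ^+ i) == t]| = (q - (t == 0%R))%N.
Proof.
move=> a0; rewrite (card_pow (fun x => phi (a * x) == t)).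
rewrite -(card_imset _ (mulfI a0)) -(card_fiber t) [in RHS](cardsD1 0).
rewrite inE linear0 eq_sym addKn; apply: eq_card => x; rewrite !inE.
apply/imsetP/andP => [[y + ->]|[x0 phix]].
  by rewrite inE => /andP[y0]; rewrite mulf_neq0.
by exists (a^-1 * x); rewrite ?inE mulVKf // phix mulf_neq0 ?invr_eq0.
Qed.

Lemma q_lt_n : (q < n)%N.
Proof. by have := q_gt1; rewrite nE; nia. Qed.

Lemma nE_mul : n = (q * (q - 1) + (q - 1))%N.
Proof. by have := q_gt1; rewrite nE; nia. Qed.

Lemma qM_gt1 : (1 < q * (q - 1))%N.
Proof. by have := q_gt1; nia. Qed.

(** The zeros are the [i] with phi(a w^i) = -b. For nonzero [a] there are q - 1 of them if b = 0 and
    q otherwise; for a = 0, all or none. *)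
Lemma wt_affine_word p : wt (affine_word p) =
  if p.2 == 0 then if p.1 == 0 then 0%N else n
  else if p.1 == 0 then (q * (q - 1))%N else (q * (q - 1) - 1)%N.
Proof.
case: p => b a /=; have := wt_zeros (affine_word (b, a)).
have -> : [set i | affine_word (b, a) 0 i == 0] = [set i : 'I_n | phi (a * w ^+ i) == - b].
  apply/setP => i; rewrite !inE mxE /= mulf_eq0 expf_eq0 (negPf D_neq0) andbF /=.
  by rewrite addrC addr_eq0.
have [-> | a0] := eqVneq a 0.
  under eq_finset do rewrite mul0r linear0 eq_sym oppr_eq0.
  have [_ | b0] := eqVneq b 0; last by rewrite cards0 addn0.
  by rewrite cardsT card_ord; lia.
rewrite card_phi_pow // oppr_eq0; have := nE_mul; have := q_gt1.
by case: eqP => _ /=; nia.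
Qed.

(** By linearity it is enough that only the zero message has weight 0, and q(q - 1) - 1 is
    positive. *)
Lemma affine_word_inj : injective affine_word.
Proof.
move=> p p' /eqP; rewrite -subr_eq0 -linearB => /eqP evB0.
apply/eqP; rewrite -subr_eq0; have := wt_affine_word (p - p'); rewrite evB0 wt0.
case: (p - p') => b a /=; rewrite -[(b, a) == 0]/((b == 0) && (a == 0)).
have := nE_mul; have := q_gt1; do 2 case: eqP => //= _; nia.
Qed.

(** * Weights and parameters of the affine code *)

Definition affine_code : {set 'rV[F]_n} := [set affine_word p | p : F^o * L].

Lemma wfreq_affine_code_card j :
  wfreq affine_code j = #|[set p : F^o * L | wt (affine_word p) == j]|.
Proof.
rewrite -(card_imset _ affine_word_inj); apply: eq_card => c; rewrite !inE.
apply/andP/imsetP => [[/imsetP[p _ ->]]|[p + ->]].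
  by move=> wtp; exists p; rewrite ?inE.
by rewrite inE => ->; rewrite imset_f.
Qed.

Lemma wfreq_affine_code j : wfreq affine_code j =
  if j == 0%N then 1%N
  else if j == (q * (q - 1) - 1)%N then ((q - 1) * (q ^ 2 - 1))%N
  else if j == (q * (q - 1))%N then (q ^ 2 - 1)%N
  else if j == (q ^ 2 - 1)%N then (q - 1)%N
  else 0%N.
Proof.
have cF0 : #|[set~ (0 : F^o)]| = (q - 1)%N by rewrite cardsC1 -qE subn1.
have cL0 : #|[set~ (0 : L)]| = (q ^ 2 - 1)%N by rewrite cardsC1 cardL subn1.
(* For each weight the messages (b, a) form a product set, whose factors are {0}, the nonzero
   elements, or empty. The four weights are distinct because q > 1. *)
have rect (A : {set F^o}) (B : {set L}) :
    (forall b a, (wt (affine_word (b, a)) == j) = (b \in A) && (a \in B)) ->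
  wfreq affine_code j = (#|A| * #|B|)%N.
  move=> AB; rewrite wfreq_affine_code_card -cardsX.
  by apply: eq_card => -[b a]; rewrite !inE AB.
have wtE' := wt_affine_word; have m1 := qM_gt1; have n_eq := nE_mul; have q1 := q_gt1.
move: m1 n_eq wtE'; rewrite -nE; set m := (q * (q - 1))%N => m1 n_eq wtE'.
case: eqP => [j0|j0].
  rewrite (rect [set 0] [set 0]) ?cards1 // => b a.
  by rewrite wtE' !inE /=; case: (a =P 0); case: (b =P 0); lia.
case: eqP => [j1|j1].
  rewrite -cF0 [in RHS]nE -cL0; apply: rect => b a; rewrite wtE' !inE /=.
  by case: (a =P 0); case: (b =P 0); lia.
case: eqP => [j2|j2].
  rewrite [in RHS]nE -cL0 -[RHS]mul1n -(cards1 (0 : F^o)); apply: rect => b a.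
  by rewrite wtE' !inE /=; case: (a =P 0); case: (b =P 0); lia.
case: eqP => [j3|j3].
  rewrite -cF0 -[RHS]muln1 -(cards1 (0 : L)); apply: rect => b a.
  by rewrite wtE' !inE /=; case: (a =P 0); case: (b =P 0); lia.
rewrite (rect set0 set0) ?cards0 // => b a.
by rewrite wtE' !inE /=; case: (a =P 0); case: (b =P 0); lia.
Qed.

Lemma three_weight_affine_code : three_weight affine_code.
Proof.
have m1 := qM_gt1; have n_eq := nE_mul; have q1 := q_gt1.
pose s := [:: (q * (q - 1) - 1); q * (q - 1); n]%N.
have eq_s : perm_eq (nz_weights affine_code) s; last exact: perm_size eq_s.
have n_gt : (q * (q - 1) < n)%N by lia.
apply: uniq_perm; first exact: undup_uniq.
  by rewrite /= !inE; lia.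
move=> j; rewrite mem_nz_weights_wfreq wfreq_affine_code !inE -nE.
have [-> | _] := eqVneq j 0%N; first by lia.
case: (j =P (q * (q - 1) - 1)%N) => _ /=; first by rewrite -lt0n muln_gt0; lia.
case: (j =P (q * (q - 1))%N) => _ /=; first by lia.
by case: (j =P n) => _ /=; lia.
Qed.

Lemma dim_messages : \dim {: (F^o * L)%type} = 3%N.
Proof.
rewrite dimvf; transitivity (1 + dim (L : vectType F))%N; first by [].
by rewrite -dimvf dimL.
Qed.

(** The code is the image of an injective linear map on a 3-dimensional space; the message (1, 1)
    attains the least weight. *)
Lemma affine_code_params : has_params affine_code 3 (q * (q - 1) - 1).
Proof.
have mem_affine c : (c \in affine_code) = (c \in limg (linfun affine_word)).
  apply/imsetP/memv_imgP => -[p _ ->]; exists p; rewrite ?memvf ?lfunE //.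
split.
  rewrite (code_dim_vspace mem_affine) limg_dim_eq.
    exact: dim_messages.
  apply/eqP; rewrite capfv; apply/lker0P => p p'; rewrite !lfunE; exact: affine_word_inj.
have m1 := qM_gt1; have n_eq := nE_mul; have q1 := q_gt1.
apply: min_dist_linear; first by rewrite mem_affine mem0v.
- by move=> x y; rewrite !mem_affine; apply: rpredB.
- by lia.
- by exists (affine_word (1, 1)); rewrite ?imset_f // wt_affine_word !oner_eq0.
move=> _ /imsetP[[b a] _ ->]; rewrite -wt_eq0 wt_affine_word /=.
by case: (a =P 0) => _; case: (b =P 0) => _ //=; lia.
Qed.

Lemma one_weight_constant_code :
  one_weight [set affine_word (b, 0) | b : F] (q ^ 2 - 1).
Proof.
apply: one_weight_linear.
  exists (affine_word (1, 0)); first by apply/imsetP; exists 1.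
  by rewrite -wt_eq0 wt_affine_word eqxx oner_eq0 -lt0n (leq_trans _ q_lt_n).
move=> _ /imsetP[b _ ->]; rewrite -wt_eq0 wt_affine_word /= eqxx -nE.
by case: (b =P 0).
Qed.

Lemma one_weight_linear_code :
  one_weight [set affine_word (0, a) | a : L] (q * (q - 1)).
Proof.
have := q_gt1 => q1.
apply: one_weight_linear.
  exists (affine_word (0, 1)); first by apply/imsetP; exists 1.
  by rewrite -wt_eq0 wt_affine_word eqxx oner_eq0; nia.
by move=> _ /imsetP[a _ ->]; rewrite -wt_eq0 wt_affine_word /= eqxx; case: (a =P 0).
Qed.

(** * The dual code *)

(** A syndrome map: [x] pairs with the word of (b, a) to b s + phi(a t), where (s, t) is the value
    at [x]. *)
Definition checks (x : 'rV[F]_n) : F^o * L :=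
  (\sum_i x 0 i * D ^+ i, \sum_i (x 0 i * D ^+ i) *: w ^+ i).

Lemma checks_is_linear : linear checks.
Proof.
move=> k x y; congr pair.
  rewrite -[RHS]/(k * (\sum_i x 0 i * D ^+ i) + \sum_i y 0 i * D ^+ i).
  by rewrite mulr_sumr -big_split; apply: eq_bigr => i _; rewrite !mxE /=; ring.
rewrite -[RHS]/(k *: (\sum_i (x 0 i * D ^+ i) *: w ^+ i)
  + \sum_i (y 0 i * D ^+ i) *: w ^+ i).
rewrite scaler_sumr -big_split; apply: eq_bigr => i _.
by rewrite !mxE /= scalerA -scalerDl; congr (_ *: _); ring.
Qed.
HB.instance Definition _ := GRing.isLinear.Build F 'rV[F]_n (F^o * L)%type _ checks checks_is_linear.

Lemma mem_dual_affine x : (x \in dual_code affine_code) = (checks x == 0).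
Proof.
have dot_word b a : (affine_word (b, a) *m x^T) 0 0 = b * (checks x).1 + phi (a * (checks x).2).
  rewrite mxE /= mulr_sumr mulr_sumr linear_sum -big_split; apply: eq_bigr => i _.
  rewrite !mxE /=; set k := x 0 i * D ^+ i.
  have -> : phi (a * (k *: w ^+ i)) = k * phi (a * w ^+ i).
    by rewrite -scalerAr linearZ.
  by rewrite /k; ring.
rewrite inE; apply/forall_inP/eqP => [x_dual | x0 _ /imsetP[[b a] _ ->]]; last first.
  by rewrite dot_word x0 /= !mulr0 linear0 addr0.
have E b a : b * (checks x).1 + phi (a * (checks x).2) = 0.
  by rewrite -dot_word; apply/eqP/x_dual/imset_f.
apply/eqP; rewrite -[checks x == 0]/(((checks x).1 == 0) && ((checks x).2 == 0)).
have := E 1 0; rewrite mul0r linear0 addr0 mul1r => ->; rewrite eqxx /=.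
(* Testing against the inverse of a nonzero second component would give phi 1 = 0. *)
apply/negPn/negP => c0; have := E 0 (checks x).2^-1.
by rewrite mul0r add0r mulVf // phi1 => /eqP; rewrite oner_eq0.
Qed.

(** Vectors supported on one coordinate give all (c, c x) with [x] nonzero. Differences of two of
    these with c = 1 give every (0, a), and together they span. *)
Lemma limg_checks : limg (linfun checks) = fullv.
Proof.
have pow_img c (x : L) : x != 0 -> (c, c *: x) \in limg (linfun checks).
  case/powP=> i <-; apply/memv_imgP.
  exists (\row_l (if l == i then c / D ^+ i else 0)); rewrite ?memvf // lfunE.
  have D0 : D ^+ i != 0 by rewrite expf_neq0.
  congr pair; rewrite (bigD1 i) //= big1 ?addr0 => [|l /negPf li].
  - by rewrite mxE eqxx divfK.
  - by rewrite mxE li mul0r.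
  - by rewrite mxE eqxx divfK.
  by rewrite mxE li mul0r scale0r.
have snd_img (a : L) : (0, a) \in limg (linfun checks).
  have [-> | a0] := eqVneq a 0; first exact: mem0v.
  (* Both [x] and [x - a] must be nonzero; such an [x] exists because q^2 > 2. *)
  have [x] : exists x, x \in [set x : L | x \notin [:: 0; a]].
    apply/card_gt0P; rewrite card_notin /= ?inE 1?eq_sym ?a0 // cardL.
    by have := q_gt1; nia.
  rewrite !inE negb_or => /andP[x0 xa].
  have -> : (0, a) = (1, 1 *: x) - (1, 1 *: (x - a)) :> F^o * L.
    by rewrite !scale1r; congr pair; rewrite /= ?subrr // opprB addrC subrK.
  by rewrite memvB ?pow_img ?subr_eq0.
apply/vspaceP => -[b a]; rewrite memvf.
have -> : (b, a) = (b, b *: 1) + (0, a - b *: 1) :> F^o * L.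
  by congr pair; rewrite /= ?addr0 // addrC subrK.
by rewrite memvD ?pow_img ?oner_eq0.
Qed.

Lemma code_dim_dual_affine : code_dim (dual_code affine_code) = (q ^ 2 - 4)%N.
Proof.
have mem_dual x : (x \in dual_code affine_code) = (x \in lker (linfun checks)).
  by rewrite mem_dual_affine memv_ker lfunE.
rewrite (code_dim_vspace mem_dual).
have := limg_ker_dim (linfun checks) fullv; rewrite capfv limg_checks dim_messages dimvf.
rewrite -[dim _]/(1 * n)%N mul1n [X in _ = X -> _]nE => /(congr1 (subn^~ 3)).
by rewrite addnK -subnDA.
Qed.

(** Absorbing D^i removes [D] from the check equations and leaves supports unchanged. *)
Definition rescaled (x : 'rV[F]_n) i := x 0 i * D ^+ i.

Lemma rescaled_eq0 x i : (rescaled x i == 0) = (x 0 i == 0).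
Proof. by rewrite mulf_eq0 expf_eq0 (negPf D_neq0) andbF orbF. Qed.

Lemma dual_affineP x :
  reflect (\sum_i rescaled x i = 0 /\ \sum_i rescaled x i *: w ^+ i = 0)
          (x \in dual_code affine_code).
Proof.
rewrite mem_dual_affine; apply: (iffP eqP) => [[] // | [s0 s1]].
by congr pair.
Qed.

Lemma wfreq_dual_affine1 : wfreq (dual_code affine_code) 1 = 0%N.
Proof.
apply: eq_card0 => x; rewrite inE; apply/andP => -[/dual_affineP[s0 _]].
rewrite wtE => /cards1P[i supp].
have x_i l : (rescaled x l != 0) = (l == i).
  by rewrite rescaled_eq0; move/setP/(_ l): supp; rewrite !inE.
move: s0; rewrite (bigD1 i) //= big1 ?addr0 => [/eqP | l].
  by apply/negP; rewrite x_i.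
by rewrite -x_i negbK => /eqP.
Qed.

(** The first check makes the two coefficients opposite; the second then forces w^i = w^j with i and
    j distinct. *)
Lemma wfreq_dual_affine2 : wfreq (dual_code affine_code) 2 = 0%N.
Proof.
apply: eq_card0 => x; rewrite inE; apply/andP => -[/dual_affineP[s0 s1]].
rewrite wtE => /cards2P[i [j [neq_ij supp]]].
have x_ij l : (rescaled x l != 0) = (l == i) || (l == j).
  by rewrite rescaled_eq0; move/setP/(_ l): supp; rewrite !inE.
have x_out l : (l != i) && (l != j) -> rescaled x l = 0.
  by rewrite -negb_or -x_ij negbK => /eqP.
move: s0 s1.
rewrite (bigD1 i) // (bigD1 j) 1?eq_sym //= big1 ?addr0 => [|l /x_out //].
rewrite (bigD1 i) // (bigD1 j) 1?eq_sym //= big1 ?addr0; last first.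
  by move=> l /x_out ->; rewrite scale0r.
move=> /eqP; rewrite addrC addr_eq0 => /eqP ->.
rewrite scaleNr -scalerBr => /eqP; rewrite scaler_eq0 subr_eq0.
rewrite (negPf (_ : rescaled x i != 0)) ?x_ij ?eqxx //= => /eqP/pow_inj/eqP.
by rewrite (negPf neq_ij).
Qed.

(** * Dual words of weight three *)

Definition support_triples (x : 'rV[F]_n) : {set 3.-tuple 'I_n} :=
  [set t : 3.-tuple 'I_n | all [pred l | x 0 l != 0] t & uniq t].

Definition ordered_words3 : {set 'rV[F]_n * 3.-tuple 'I_n} :=
  [set p | (p.1 \in [set x in dual_code affine_code | wt x == 3%N])
    && (p.2 \in support_triples p.1)].

(** Each support of size 3 has 3! = 6 orderings. *)
Lemma card_ordered_words3 :
  #|ordered_words3| = (6 * wfreq (dual_code affine_code) 3)%N.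
Proof.
rewrite mulnC; apply: card_dep_pair => x; rewrite inE => /andP[_ /eqP wtx].
rewrite card_uniq_tuples; suff -> : #|[pred l | x 0 l != 0]| = 3%N by [].
by rewrite -wtx wtE cardsE.
Qed.

Lemma sum_support3 (V : zmodType) (G : 'I_n -> V) i j k :
    uniq [:: i; j; k] -> (forall l, l \notin [:: i; j; k] -> G l = 0) ->
  \sum_l G l = G i + G j + G k.
Proof.
move=> ijk G0; rewrite (bigID [in [:: i; j; k]]) /= [X in _ + X]big1 ?addr0 //.
by rewrite -big_uniq //= !big_cons big_nil /= addr0 addrA.
Qed.

Lemma ordered_words3P x i j k :
  reflect [/\ uniq [:: i; j; k],
              forall l, (rescaled x l != 0) = (l \in [:: i; j; k]),
              rescaled x i + rescaled x j + rescaled x k = 0 &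
              rescaled x i *: w ^+ i + rescaled x j *: w ^+ j + rescaled x k *: w ^+ k = 0]
          ((x, [tuple i; j; k]) \in ordered_words3).
Proof.
rewrite in_set in_set [_ \in support_triples _]in_set.
have out l : (forall l, (rescaled x l != 0) = (l \in [:: i; j; k])) ->
    l \notin [:: i; j; k] -> rescaled x l = 0.
  by move=> supp; rewrite -supp negbK => /eqP.
apply: (iffP andP) => [[/andP[/dual_affineP[s0 s1] wt3] /andP[x_ijk ijk]] |
                      [ijk supp s0 s1]].
  have supp l : (rescaled x l != 0) = (l \in [:: i; j; k]).
    move: x_ijk; rewrite /= andbT => /and3P[xi xj xk].
    (* Three distinct positions inside a support of size 3 are all of it. *)
    rewrite rescaled_eq0; suff E : [set l in [:: i; j; k]] = [set l | x 0 l != 0].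
      by move/setP/(_ l): E; rewrite !inE.
    apply/eqP; rewrite eqEcard -wtE (eqP wt3) cardsE (card_uniqP ijk) andbT.
    by apply/subsetP => m; rewrite !inE => /or3P[] /eqP ->.
  split=> //; [rewrite -s0 | rewrite -s1]; apply/esym/sum_support3 => // l.
    exact: out.
  by move/out => -> //; rewrite scale0r.
split; last first.
  by apply/andP; split=> //=; rewrite -!rescaled_eq0 !supp !inE !eqxx !orbT.
apply/andP; split.
  apply/dual_affineP; split; rewrite (@sum_support3 _ _ i j k) // => l; first exact: out.
  by move/out => -> //; rewrite scale0r.
rewrite wtE /=; apply/eqP; rewrite -[RHS](card_uniqP ijk); apply: eq_card => l.
by rewrite !inE -rescaled_eq0 supp !inE.
Qed.

(** The conditions here and in [point_pairs] are phrased as lists of excluded values, so that the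
    counts follow from [card_notin] one component at a time. *)
Definition coef_pairs : {set F * F} :=
  [set u | (u.1 \in [set~ 0]) && (u.2 \in [set v | v \notin [:: 0; - u.1]])].

Definition point_pairs (u : F * F) : {set L * L} :=
  [set X | (X.1 \in [set~ 0]) &&
           (X.2 \in [set Y | Y \notin [:: 0; X.1; - (u.1 / u.2) *: X.1]])].

Lemma coef_pairsP u :
  reflect [/\ u.1 != 0, u.2 != 0 & u.1 + u.2 != 0] (u \in coef_pairs).
Proof.
rewrite !inE negb_or [u.1 + _]addrC addr_eq0; exact: and3P.
Qed.

Lemma point_pairsP u X : u.2 != 0 ->
  reflect [/\ X.1 != 0, X.2 != 0, X.1 != X.2 & u.1 *: X.1 + u.2 *: X.2 != 0]
          (X \in point_pairs u).
Proof.
move=> u2; rewrite !inE !negb_or.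
have -> : (X.2 == - (u.1 / u.2) *: X.1) = (u.1 *: X.1 + u.2 *: X.2 == 0).
  rewrite scaleNr -addr_eq0 -(inj_eq (scalerI u2)) scaler0 scalerDr scalerA.
  by rewrite mulrCA divff // mulr1 addrC.
by rewrite (eq_sym X.2 X.1); exact: and4P.
Qed.

Definition config : {set (F * F) * (L * L)} :=
  [set p | (p.1 \in coef_pairs) && (p.2 \in point_pairs p.1)].

Lemma mem_config u X :
  ((u, X) \in config) = (u \in coef_pairs) && (X \in point_pairs u).
Proof. by rewrite in_set. Qed.

Lemma card_config :
  #|config| = ((q ^ 2 - 3) * (q ^ 2 - 1) * (q - 2) * (q - 1))%N.
Proof.
have cu : #|coef_pairs| = ((q - 1) * (q - 2))%N.
  rewrite (card_dep_pair (B := fun u : F => [set v | v \notin [:: 0; - u]]) (m := q - 2)).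
    by rewrite cardsC1 qE subn1.
  move=> u; rewrite !inE => u0; rewrite card_notin ?qE //.
  by rewrite /= inE eq_sym oppr_eq0 u0.
have cp u : u \in coef_pairs -> #|point_pairs u| = ((q ^ 2 - 1) * (q ^ 2 - 3))%N.
  case/coef_pairsP=> u1 u2 u12.
  rewrite (card_dep_pair (m := q ^ 2 - 3)
    (B := fun X : L => [set Y | Y \notin [:: 0; X; - (u.1 / u.2) *: X]])).
    by rewrite cardsC1 cardL subn1.
  move=> X; rewrite !inE => X0; rewrite card_notin ?cardL //= !inE !negb_or andbT.
  rewrite eq_sym X0 eq_sym scaler_eq0 negb_or X0 oppr_eq0 mulf_neq0 ?invr_eq0 //=.
  (* The excluded values X and -(u/v) X differ because 1 + u/v = (u + v)/v is nonzero. *)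
  rewrite -subr_eq0 -{1}[X]scale1r -scalerBl scaler_eq0 negb_or X0 andbT opprK.
  by rewrite -(divff u2) -mulrDl addrC mulf_neq0 ?invr_eq0.
by rewrite (card_dep_pair cp) cu mulnC [((q ^ 2 - 1) * _)%N]mulnC -!mulnA [((q - 1) * _)%N]mulnC.
Qed.

Definition config_of (p : 'rV[F]_n * 3.-tuple 'I_n) : (F * F) * (L * L) :=
  let i := tnth p.2 0 in let j := tnth p.2 1 in
  ((rescaled p.1 i, rescaled p.1 j), (w ^+ i : L, w ^+ j : L)).

Lemma tuple3 (t : 3.-tuple 'I_n) : exists i j k, t = [tuple i; j; k].
Proof.
case: t => [[|i [|j [|k []]]] //= sz]; exists i, j, k; exact: val_inj.
Qed.

Lemma config_ofE x i j k :
  config_of (x, [tuple i; j; k]) = ((rescaled x i, rescaled x j), (w ^+ i, w ^+ j)).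
Proof. by []. Qed.

(** The first check determines the third coefficient, and then the second check determines the third
    position. *)
Lemma config_of_inj : {in ordered_words3 &, injective config_of}.
Proof.
move=> [x t] [x' t'].
have [i [j [k ->]]] := tuple3 t; have [i' [j' [k' ->]]] := tuple3 t'.
move=> /ordered_words3P[ijk supp s0 s1] /ordered_words3P[_ supp' s0' s1'].
rewrite !config_ofE => -[xi xj /pow_inj ii' /pow_inj jj']; subst i' j'.
rewrite -xi -xj in s0' s1'.
have xk : rescaled x k = rescaled x' k'.
  by apply: (addrI (rescaled x i + rescaled x j)); rewrite s0 s0'.
have kk' : k = k'.
  apply/pow_inj/(@scalerI _ _ (rescaled x k)); first by rewrite supp !inE eqxx !orbT.
  by apply: (addrI (rescaled x i *: w ^+ i + rescaled x j *: w ^+ j)); rewrite s1 xk s1'.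
subst k'; congr pair; apply/rowP => l.
have D0 : D ^+ l != 0 by rewrite expf_neq0.
apply: (mulIf D0); rewrite -!/(rescaled _ _).
have := supp l; have := supp' l; rewrite !inE.
have [-> // | _] := eqVneq l i; have [-> // | _] := eqVneq l j.
by have [-> // | _] := eqVneq l k => /negbFE/eqP -> /negbFE/eqP ->.
Qed.

Lemma config_of_image : config_of @: ordered_words3 = config.
Proof.
apply/setP => p; apply/imsetP/idP.
  case=> -[x t]; have [i [j [k ->]]] := tuple3 t.
  move=> /ordered_words3P[ijk supp s0 s1] ->.
  have [xi xj xk] : [/\ rescaled x i != 0, rescaled x j != 0 & rescaled x k != 0].
    by rewrite !supp !inE !eqxx !orbT.
  have ij : i != j.
    by move: ijk; rewrite /= !inE negb_or => /andP[/andP[]].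
  rewrite config_ofE mem_config; apply/andP; split.
    apply/coef_pairsP; split=> //=; move/eqP: s0.
    by rewrite addr_eq0 => /eqP->; rewrite oppr_eq0.
  apply/point_pairsP => //=; split; rewrite ?pow_neq0 // ?(inj_eq pow_inj) //.
  move/eqP: s1; rewrite addr_eq0 => /eqP->.
  by rewrite oppr_eq0 scaler_eq0 negb_or xk pow_neq0.
case: p => -[u v] [X Y]; rewrite mem_config.
case/andP=> /coef_pairsP[/= u0 v0 uv0] /(point_pairsP _ (v0 : (u, v).2 != 0))[/= X0 Y0 XY XY0].
have [i Xi] := powP X0; have [j Yj] := powP Y0.
(* The third coefficient has to be -(u + v), so the third point is this weighted mean. It is nonzero
   by the last condition on the configuration, and differs from [X] and [Y] since [X], [Y] are
   distinct and [u], [v] nonzero. *)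
have [k Zk] : exists k : 'I_n, w ^+ k = (u + v)^-1 *: (u *: X + v *: Y).
  by apply: powP; rewrite scaler_eq0 negb_or invr_eq0 uv0.
have Zk' : (u + v) *: w ^+ k = u *: X + v *: Y by rewrite Zk scalerA divff // scale1r.
have ij : i != j by apply: contraNneq XY => ij; rewrite -Xi -Yj ij.
have ik : i != k.
  apply: contraNneq XY => ik; move/eqP: Zk'; rewrite -ik Xi scalerDl.
  by rewrite (inj_eq (addrI _)) (inj_eq (scalerI v0)).
have jk : j != k.
  apply: contraNneq XY => jk; move/eqP: Zk'; rewrite -jk Yj scalerDl.
  by rewrite (inj_eq (addIr _)) (inj_eq (scalerI u0)) eq_sym.
pose y l := if l == i then u else if l == j then v else if l == k then - (u + v) else 0.
pose x : 'rV[F]_n := \row_l (y l / D ^+ l).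
have xE l : rescaled x l = y l by rewrite /rescaled mxE divfK // expf_neq0.
have [yi yj yk] : [/\ y i = u, y j = v & y k = - (u + v)].
  by rewrite /y !eqxx ![_ == i]eq_sym (negPf ij) (negPf ik) eq_sym (negPf jk).
exists (x, [tuple i; j; k]); last by rewrite config_ofE !xE yi yj Xi Yj.
apply/ordered_words3P; rewrite !xE yi yj yk; split.
- by rewrite /= !inE negb_or ij ik jk.
- move=> l; rewrite xE !inE /y; case: (l =P i) => _ //; case: (l =P j) => _ //.
  by case: (l =P k) => _; rewrite ?oppr_eq0 ?eqxx.
- by rewrite subrr.
by rewrite Xi Yj scaleNr Zk' subrr.
Qed.

Lemma wfreq_dual_affine3 : (6 * wfreq (dual_code affine_code) 3 =
  (q ^ 2 - 3) * (q ^ 2 - 1) * (q - 2) * (q - 1))%N.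
Proof.
by rewrite -card_ordered_words3 -card_config -config_of_image (card_in_imset config_of_inj).
Qed.

Lemma dual_affine_params :
  (2 < q)%N -> has_params (dual_code affine_code) (q ^ 2 - 4) 3.
Proof.
move=> q_gt2; split; first exact: code_dim_dual_affine.
apply: min_dist_linear => //.
- by rewrite mem_dual_affine linear0.
- by move=> x y; rewrite !mem_dual_affine linearB /= => /eqP-> /eqP->; rewrite subrr.
(* The factor q - 2 is positive exactly when q > 2. *)
- have : (0 < wfreq (dual_code affine_code) 3)%N.
    by rewrite -(ltn_pmul2l (isT : 0 < 6)%N) wfreq_dual_affine3 muln0 !muln_gt0; nia.
  by case/card_gt0P => c; rewrite inE => /andP[Cc /eqP wtc]; exists c.
move=> c Cc; rewrite -wt_eq0.
have wt_neq j : wfreq (dual_code affine_code) j = 0%N -> wt c != j.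
  by move=> /card0_eq/(_ c); rewrite inE Cc => /negbT.
have := wt_neq _ wfreq_dual_affine1; have := wt_neq _ wfreq_dual_affine2.
by case: (wt c) => [|[|[|]]].
Qed.

End AffineCode.

(** * Reduction to affine functions *)

Lemma prim_root_exprz (K : fieldType) (n : nat) (z : K) (k : int) :
  n.-primitive_root z -> coprimez k n -> n.-primitive_root (z ^ k).
Proof.
move=> z_prim co_kn; have n_gt0 := prim_order_gt0 z_prim.
have z0 : z != 0.
  by rewrite -unitfE -(unitrX_pos _ n_gt0) (prim_expr_order z_prim) unitr1.
have kn : (k %% n)%Z = `|(k %% n)%Z|%N by rewrite gez0_abs // modz_ge0 // -lt0n.
(* Reducing the exponent modulo [n] replaces the integer power by a natural one. *)
have -> : z ^ k = z ^+ `|(k %% n)%Z|%N.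
  rewrite {1}(divz_eq k n) expfzDr // kn [(_ %/ _)%Z * _]mulrC -exprz_exp.
  by rewrite -exprnP (prim_expr_order z_prim) exp1rz mul1r.
rewrite (prim_root_exp_coprime _ z_prim); move: co_kn.
by rewrite /coprimez -gcdz_modl kn.
Qed.

(** [coord] is linear on the whole space even when its family spans only the line through 1. *)
Lemma exists_linear_form (K : fieldType) (V : falgType K) :
  exists phi : {linear V -> K^o}, phi 1 = 1.
Proof.
pose f (v : V) : K^o := coord [tuple (1 : V)] ord0 v.
have f_lin : linear f by move=> k u v; rewrite /f linearP.
pose fM := GRing.isLinear.Build K V K^o _ f f_lin.
pose phi : {linear V -> K^o} := HB.pack f fM.
exists phi; have := coord_free (X := [tuple (1 : V)]) ord0 ord0; apply.
by rewrite /= /free span_seq1 dim_vline oner_eq0.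
Qed.

Lemma griesmer_affine q : (1 < q)%N -> griesmer_optimal q (q ^ 2 - 1) 3 (q * (q - 1) - 1).
Proof.
move=> q1; rewrite /griesmer_optimal !big_ord_recr big_ord0 /= /ceil_div add0n.
rewrite expn0 expn1 addnK divn1.
(* Division with remainder: the ceilings are d, q - 1 and 1, with sum q^2 - 1. *)
have -> : (q * (q - 1) - 1 + q - 1 = (q - 1) * q + (q - 2))%N by nia.
have -> : (q * (q - 1) - 1 + q ^ 2 - 1 = 1 * q ^ 2 + (q ^ 2 - q - 2))%N by nia.
rewrite !divnMDl ?expn_gt0; [|lia|lia].
by rewrite !divn_small; nia.
Qed.

(** * Degrees and coprimality of the two minimal polynomials *)

Section Degree.
Variables (F : finFieldType) (L : fieldExtType F) (h1 h2 : {poly F}) (x1 x2 : L).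
Hypotheses (dimL : \dim {: L} = 2%N).
Hypotheses (h1E : map_poly (in_alg L) h1 = minPoly 1%VS x1).
Hypotheses (h2E : map_poly (in_alg L) h2 = minPoly 1%VS x2).
Hypotheses (x1_in : x1 \in 1%VS) (x2_notin : x2 \notin 1%VS).

Lemma size_minPoly1 : size h1 = 2%N.
Proof.
rewrite -(size_map_poly (in_alg L)) h1E size_minPoly.
by move: x1_in; rewrite -adjoin_deg_eq1 => /eqP ->.
Qed.

(** The degree is at most 2 by dimension, and it is not 1 because [x2] lies outside F. *)
Lemma size_minPoly2 : size h2 = 3%N.
Proof.
rewrite -(size_map_poly (in_alg L)) h2E size_minPoly; congr _.+1.
have := x2_notin; rewrite -adjoin_deg_eq1.
have : (adjoin_degree 1 x2 <= 2)%N.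
  by rewrite adjoin_degreeE dimv1 divn1 -dimL dimvS ?subvf.
have : (0 < adjoin_degree 1 x2)%N by [].
by case: (adjoin_degree 1 x2) => [|[|[|]]].
Qed.

(** Otherwise X - x1 would be a factor of the irreducible quadratic [h2]. *)
Lemma coprimep_minPoly12 : coprimep h1 h2.
Proof.
rewrite -(coprimep_map (in_alg L)) h1E (minPoly_XsubC x1_in) coprimep_sym coprimep_XsubC.
apply/negP; rewrite -dvdp_XsubCl h2E => dv.
have Xo : 'X - x1%:P \is a polyOver 1%VS by rewrite polyOverXsubC.
have := minPoly_irr Xo dv; rewrite -h2E.
by case/orP => /eqp_size; rewrite size_XsubC ?size_poly1 ?size_map_poly ?size_minPoly2.
Qed.

Lemma minPoly_dvd_Xn1 (h : {poly F}) (x : L) n :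
  map_poly (in_alg L) h = minPoly 1%VS x -> x ^+ n = 1 -> h %| 'X^n - 1.
Proof.
move=> hE xn; rewrite -(dvdp_map (in_alg L)) hE rmorphB /= map_polyXn rmorph1.
apply: minPoly_dvdp; first by rewrite rpredB ?rpred1 ?rpredX ?polyOverX.
by rewrite /root !hornerE xn subrr.
Qed.

End Degree.

(* F = F_q, L = F_{q^2} (a degree-2 extension of F), gamma primitive in L;
   h1 = h_{(q+1)e1}, h2 = h_{e2} are the minimal polynomials over F of
   gamma^{-(q+1)e1} and gamma^{-e2}. *)
Theorem theorem1 (F : finFieldType) (L : fieldExtType F) (q : nat)
    (gamma : L) (e1 e2 : int) (h1 h2 : {poly F}) :
  #|F| = q ->
  \dim {: L} = 2%N ->
  (q ^ 2 - 1)%N.-primitive_root gamma ->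
  map_poly (in_alg L) h1 = minPoly 1%VS (gamma ^ (- ((q + 1)%N%:Z * e1))) ->
  map_poly (in_alg L) h2 = minPoly 1%VS (gamma ^ (- e2)) ->
  coprimez (q%:Z - 1) (2 * e1 - e2) ->
  coprimez (q%:Z + 1) e2 ->
  (* (A) *)
  [/\ size h1 = 2%N, size h2 = 3%N,
      cyclic_code (q ^ 2 - 1) h1 != cyclic_code (q ^ 2 - 1) h2,
      one_weight (cyclic_code (q ^ 2 - 1) h1) (q ^ 2 - 1)
    & one_weight (cyclic_code (q ^ 2 - 1) h2) (q * (q - 1))] /\
  (* (B) *)
  let C := cyclic_code (q ^ 2 - 1) (h1 * h2) in
  [/\ has_params C 3 (q * (q - 1) - 1),
      griesmer_optimal q (q ^ 2 - 1) 3 (q * (q - 1) - 1),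
      three_weight C
    & (forall j : nat, wfreq C j =
         if j == 0%N then 1%N
         else if j == (q * (q - 1) - 1)%N then ((q - 1) * (q ^ 2 - 1))%N
         else if j == (q * (q - 1))%N then (q ^ 2 - 1)%N
         else if j == (q ^ 2 - 1)%N then (q - 1)%N
         else 0%N)] /\
  [/\ wfreq (dual_code C) 1 = 0%N /\ wfreq (dual_code C) 2 = 0%N,
      (6 * wfreq (dual_code C) 3 = (q ^ 2 - 3) * (q ^ 2 - 1) * (q - 2) * (q - 1))%N
    & (2 < q)%N -> has_params (dual_code C) (q ^ 2 - 4) 3].

Proof.
move=> qE dimL g_prim h1E h2E co1 co2.
set n := (q ^ 2 - 1)%N in g_prim *.
have q1 : (1 < q)%N by rewrite -qE; apply: finNzRing_gt1.
have n_gt0 : (0 < n)%N := prim_order_gt0 g_prim.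
have g0 : gamma != 0.
  by rewrite -unitfE -(unitrX_pos _ n_gt0) (prim_expr_order g_prim) unitr1.
pose delta := gamma ^ ((q + 1)%N%:Z * e1).
pose w := gamma ^ (e2 - (q + 1)%N%:Z * e1).
have g_expn z : (gamma ^ z) ^+ n = 1.
  by rewrite exprnP exprz_exp mulrC -exprz_exp -exprnP (prim_expr_order g_prim) exp1rz.
have betaE : gamma ^ e2 = delta * w by rewrite -expfzDr // addrC subrK.
have w_prim : n.-primitive_root w.
  apply: prim_root_exprz => //.
  have -> : n%:Z = (q%:Z - 1) * (q%:Z + 1) by rewrite /n; nia.
  (* The exponent of [w] is congruent to e2 - 2 e1 modulo q - 1 and to e2 modulo q + 1. *)
  rewrite coprimez_sym coprimezMl; apply/andP; split.
    have -> : e2 - (q + 1)%N%:Z * e1 = - e1 * (q%:Z - 1) - (2 * e1 - e2).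
      by rewrite PoszD; ring.
    by rewrite /coprimez gcdzMDl -/(coprimez _ _) coprimezN.
  have -> : e2 - (q + 1)%N%:Z * e1 = - e1 * (q%:Z + 1) + e2 by rewrite PoszD; ring.
  by rewrite /coprimez gcdzMDl.
have in1P (x : L) : (x \in 1%VS) = (x ^+ q == x).
  by rewrite (Fermat's_little_theorem 1%AS) dimv1 expn1 qE.
(* F is the fixed set of x -> x^q, and delta^(q - 1) = gamma^(e1 n) = 1. *)
have [D deltaE] : exists D : F, delta = D%:A.
  apply/vlineP; rewrite in1P -[q](subnK (ltnW q1)) exprD expr1.
  suff -> : delta ^+ (q - 1) = 1 by rewrite mul1r.
  rewrite exprnP exprz_exp; have -> : (q + 1)%N%:Z * e1 * (q - 1)%N = e1 * n.
    have -> : n%:Z = (q - 1)%N%:Z * (q + 1)%N%:Z by rewrite /n; nia.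
    by ring.
  by rewrite -exprz_exp -exprnP g_expn.
have D0 : D != 0.
  by apply: contraTneq (expfz_neq0 ((q + 1)%N%:Z * e1) g0) => D0;
     rewrite -/delta deltaE D0 scale0r eqxx.
have x1E : gamma ^ (- ((q + 1)%N%:Z * e1)) = delta^-1 by rewrite -invr_expz.
have x2E : gamma ^ (- e2) = (gamma ^ e2)^-1 by rewrite -invr_expz.
have x1_in : gamma ^ (- ((q + 1)%N%:Z * e1)) \in 1%VS.
  by rewrite x1E rpredV; apply/vlineP; exists D.
have x2_notin : gamma ^ (- e2) \notin 1%VS.
  rewrite x2E rpredV betaE; apply/negP => beta_in.
  (* Were gamma^e2 in F, so would be its quotient [w] by [delta]; then w^(q - 1) = 1, against the
     order q^2 - 1 of [w]. *)
  have : w \in 1%VS.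
    have -> : w = gamma ^ (- ((q + 1)%N%:Z * e1)) * (delta * w).
      by rewrite x1E mulKf // expfz_neq0.
    exact: (@memvM _ _ 1%AS).
  rewrite in1P -{1}[q](subnK (ltnW q1)) exprD expr1 -{3}[w]mul1r.
  have w0 : w != 0 := expfz_neq0 _ g0.
  move=> /eqP/(mulIf w0)/eqP; rewrite -(prim_order_dvd w_prim).
  by move/dvdn_leq; rewrite subn_gt0 q1 /n => /(_ isT); nia.
have sz1 := size_minPoly1 h1E x1_in.
have sz2 := size_minPoly2 dimL h2E x2_notin.
have dv1 := minPoly_dvd_Xn1 h1E (g_expn _).
have dv2 := minPoly_dvd_Xn1 h2E (g_expn _).
have dv12 : h1 * h2 %| 'X^n - 1.
  by rewrite Gauss_dvdp ?dv1 //; apply: coprimep_minPoly12 h1E h2E x1_in x2_notin.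
have [phi phi1] := exists_linear_form (finvect_type L).
pose word := @affine_word F L n phi w D.
have word_inj : injective word by exact: (affine_word_inj qE dimL).
have cC1 b : word (b, 0) \in cyclic_code n h1.
  have -> : word (b, 0) = \row_(i < n) (phi (b%:A * delta ^+ i) : F).
    apply/rowP => i; rewrite !mxE /= mul0r linear0 addr0 mulrC.
    rewrite deltaE -scalerAl mul1r exprZn expr1n scalerA linearZ /= phi1.
    exact: esym (mulr1 _).
  apply: linear_orbit_cyclic_code => //; first exact: g_expn.
  by rewrite h1E x1E; apply: root_minPoly.
have cC2 a : word (0, a) \in cyclic_code n h2.
  have -> : word (0, a) = \row_(i < n) (phi (a * (gamma ^ e2) ^+ i) : F).
    apply/rowP => i; rewrite !mxE /= add0r betaE deltaE.
    by rewrite -scalerAl mul1r exprZn -scalerAr linearZ.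
  have root_h2 : root (map_poly (in_alg L) h2) (gamma ^ e2)^-1.
    by rewrite h2E x2E; apply: root_minPoly.
  exact: linear_orbit_cyclic_code.
have C1E : cyclic_code n h1 = [set word (b, 0) | b : F].
  apply: cyclic_codeE => //; last by rewrite sz1.
  by move=> b b' /word_inj [].
have C2E : cyclic_code n h2 = [set word (0, a) | a : finvect_type L].
  apply: cyclic_codeE => //; last by rewrite sz2 (cardL qE dimL) qE.
  by move=> a a' /word_inj [].
have CE : cyclic_code n (h1 * h2) = affine_code n phi w D.
  apply: cyclic_codeE => //; last first.
    rewrite size_mul -?size_poly_gt0 ?sz1 ?sz2 //= card_prod (cardL qE dimL).
    by rewrite -[LHS]/(#|F| * q ^ 2)%N qE -expnS.
  (* Each word splits into one from each factor's code, both contained in the code of [h1 * h2]. *)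
  move=> [b a]; have -> : (b, a) = (b, 0) + (0, a) :> F^o * finvect_type L.
    by congr pair; rewrite /= ?addr0 ?add0r.
  rewrite linearD; apply: cyclic_codeD.
    exact: subsetP (cyclic_codeS n_gt0 (dvdp_mulr _ (dvdpp h1)) dv12) _ (cC1 b).
  exact: subsetP (cyclic_codeS n_gt0 (dvdp_mull _ (dvdpp h2)) dv12) _ (cC2 a).
have ow1 := one_weight_constant_code qE dimL erefl w_prim D0 phi1.
have ow2 := one_weight_linear_code qE dimL erefl w_prim D0 phi1.
split.
  split=> //; [|by rewrite C1E|by rewrite C2E].
  (* Equal codes would have equal weights, but q^2 - 1 exceeds q(q - 1). *)
  apply/eqP => C12; move: ow2; rewrite /one_weight -C2E -C12 C1E ow1 => -[].
  by rewrite /n; nia.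
rewrite /= CE; split.
  split.
  - exact: affine_code_params qE dimL erefl w_prim D0 phi1.
  - exact: griesmer_affine.
  - exact: three_weight_affine_code qE dimL erefl w_prim D0 phi1.
  exact: wfreq_affine_code qE dimL erefl w_prim D0 phi1.
split; first split.
- by apply: wfreq_dual_affine1.
- by apply: wfreq_dual_affine2.
- by apply: wfreq_dual_affine3.
by apply: dual_affine_params.
Qed.
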